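(* Let $q$ be a prime power, $h\ge 6$ with $h\ne 7$, $3\le k\le q^h-1$, and let $r_0,r_1,r_2$ be positive integers with $r_0\le h/6$, $r_1\le 2h/3$, $r_2\le h/2$ and $r_1+r_2=h+r_0$. Put $V:=(\mathbb{F}_{q^h})^{k-1}\times(\mathbb{F}_q)^{r_0}$, regarded as an $\mathbb{F}_q$-vector space of dimension $r=(k-1)h+r_0$. Let $\xi\in\mathbb{F}_{q^h}$ be such that $\{1,\xi,\dots,\xi^{h-1}\}$ is an $\mathbb{F}_q$-basis of $\mathbb{F}_{q^h}$. Let $Y_1,Y_2,Y_3$ be $\mathbb{F}_q$-subspaces of $\mathbb{F}_{q^h}$ of $\mathbb{F}_q$-dimension $r_1$ with $Y_1\cap Y_2\cap Y_3=\{0\}$, and let $S_1,S_2,S_3$ be $\mathbb{F}_q$-subspaces of $\mathbb{F}_{q^h}$ of $\mathbb{F}_q$-dimension $r_2$ with $S_1\cap S_2=S_1\cap S_3=S_2\cap S_3=\{0\}$. For $\alpha\in\mathbb{F}_{q^h}$ define $$W_\alpha:=\Big\{(x_1,\dots,x_{k-1},z_1,\dots,z_{r_0})\in V:\ \sum_{i=1}^{k-1}\alpha^{i-1}x_i+\alpha^{k-1}\sum_{j=1}^{r_0}\xi^{j-1}z_j=0\Big\},$$ and for $i\in\{1,2,3\}$ define $$W_{\infty_i}:=\{(x_1,\dots,x_{k-3},y,s,0,\dots,0)\in V:\ x_1,\dots,x_{k-3}\in\mathbb{F}_{q^h},\ y\in Y_i,\ s\in S_i\}.$$ Then the family $L:=\{W_\alpha:\alpha\in\mathbb{F}_{q^h}\}\cup\{W_{\infty_1},W_{\infty_2},W_{\infty_3}\}$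 of $q^h+3$ subspaces is a $(k-1)$-packing of $V$.
   Context: A family of $\mathbb{F}_q$-subspaces of an $\mathbb{F}_q$-vector space $V$ is a $\lambda$-packing if every $1$-dimensional $\mathbb{F}_q$-subspace of $V$ is contained in at most $\lambda$ members of the family. Convention: $0^0=1$ (so for $\alpha=0$ the term with $i=1$ equals $x_1$). *)

(* Defs.v *)
From HB Require Import structures.
From mathcomp Require Import all_boot all_order all_algebra all_field.

Set Implicit Arguments.
Unset Strict Implicit.
Unset Printing Implicit Defensive.

Import GRing.Theory.
Local Open Scope ring_scope.

(* A family is a sequence of subspaces, counted with multiplicity. *)
Definition packing (K : fieldType) (V : vectType K) (lambda : nat)
    (s : seq {vspace V}) : Prop :=
  forall P : {vspace V}, \dim P = 1%N ->
    (count (fun U => (P <= U)%VS) s <= lambda)%N.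

Section Family.

Variables (F : finFieldType) (L : fieldExtType F) (k r0 : nat).

(* Coordinates are numbered from 0: [v.1 i] is x_(i+1) and [v.2 0 j] is
   z_(j+1). *)
Definition ambient : vectType F :=
  ({ffun 'I_k.-1 -> L} * 'rV[F]_r0)%type.

Definition Wform (xi alpha : L) (v : ambient) : L :=
  \sum_(i < k.-1) alpha ^+ i * v.1 i
  + alpha ^+ k.-1 * \sum_(j < r0) v.2 0 j *: xi ^+ j.

Fact Wform_is_linear xi alpha : linear (Wform xi alpha).
Proof.
move=> a u v; rewrite /Wform scalerDr addrACA; congr (_ + _).
  rewrite scaler_sumr -big_split /=; apply: eq_bigr => i _.
  by rewrite !ffunE mulrDr scalerAr.
rewrite scalerAr -mulrDr; congr (_ * _).
rewrite scaler_sumr -big_split /=; apply: eq_bigr => j _.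
by rewrite !mxE scalerDl scalerA.
Qed.

HB.instance Definition _ xi alpha :=
  GRing.isLinear.Build F ambient L _ (Wform xi alpha)
    (Wform_is_linear xi alpha).

Definition W (xi alpha : L) : {vspace ambient} :=
  lker (linfun (Wform xi alpha)).

Lemma mem_W (xi alpha : L) (v : ambient) : (v \in W xi alpha) = (Wform xi alpha v == 0).
Proof. by rewrite memv_ker lfunE. Qed.

Definition xcoord (i : 'I_k.-1) (v : ambient) : L := v.1 i.

Fact xcoord_is_linear i : linear (xcoord i).
Proof. by move=> a u v; rewrite /xcoord !ffunE. Qed.

HB.instance Definition _ i :=
  GRing.isLinear.Build F ambient L _ (xcoord i) (xcoord_is_linear i).

Definition zcoord (v : ambient) : 'rV[F]_r0 := v.2.

Fact zcoord_is_linear : linear zcoord.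
Proof. by []. Qed.

HB.instance Definition _ :=
  GRing.isLinear.Build F ambient 'rV[F]_r0 _ zcoord zcoord_is_linear.

(* For k >= 3 each of the two intersections has exactly one term, the
   coordinates 0, ..., k - 4 being unconstrained. *)
Definition Winf (Y S : {vspace L}) : {vspace ambient} :=
  ((\bigcap_(i < k.-1 | i == (k - 3)%N :> nat) (linfun (xcoord i) @^-1: Y))
   :&: (\bigcap_(i < k.-1 | i == (k - 2)%N :> nat) (linfun (xcoord i) @^-1: S))
   :&: lker (linfun zcoord))%VS.

Lemma mem_Winf (Y S : {vspace L}) (v : ambient) :
  reflect [/\ forall i : 'I_k.-1, i = (k - 3)%N :> nat -> v.1 i \in Y,
              forall i : 'I_k.-1, i = (k - 2)%N :> nat -> v.1 i \in S
            & v.2 = 0]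
          (v \in Winf Y S).
Proof.
have capP m (U : {vspace L}) : reflect
    (forall i : 'I_k.-1, i = m :> nat -> v.1 i \in U)
    (v \in \bigcap_(i < k.-1 | i == m :> nat) (linfun (xcoord i) @^-1: U))%VS.
  rewrite memvE; apply: (iffP subv_bigcapP) => vU i /eqP im.
    by have:= vU i im; rewrite -memvE -memv_preim lfunE.
  by rewrite -memvE -memv_preim lfunE; apply: vU.
rewrite !memv_cap memv_ker lfunE -andbA.
by apply: (iffP and3P) => -[/capP ? /capP ? /eqP ?].
Qed.

(* [finvect_type L] is [L] with its finite type structure. *)
Definition Lfamily (xi : L) (Y S : 'I_3 -> {vspace L}) :
    seq {vspace ambient} :=
  [seq W xi alpha | alpha : finvect_type L] ++
  [seq Winf (Y i) (S i) | i : 'I_3].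

End Family.

(* Main.v *)
Require Import Defs.
From mathcomp Require Import all_boot all_order all_algebra all_field.
From mathcomp Require Import zify.

Import GRing.Theory.
Local Open Scope ring_scope.

(** A vector v lies in W_alpha iff alpha is a root of the polynomial of degree
    at most k - 1 whose coefficients are the coordinates of v, the last one
    being the combination of powers of xi given by z. A nonzero v thus lies in
    at most k - 1 of the W_alpha, and membership in the other three subspaces
    is paid for by vanishing leading coefficients: v in one of them forces
    z = 0, v in two of them forces s = 0 as well, and v in all three also
    forces y = 0. *)

(** [\poly] expects coefficients indexed by [nat], hence [insub]; its default 0 is never reached,
    since only indices below [k.-1] occur. *)
Definition Wpoly {F : finFieldType} {L : fieldExtType F} {k r0 : nat} (xi : L)
    (v : ambient L k r0) : {poly L} :=
  \poly_(i < k.-1) oapp v.1 0 (insub i)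
  + (\sum_(j < r0) v.2 0 j *: xi ^+ j) *: 'X^(k.-1).

Section Packing.

Context {F : finFieldType} {L : fieldExtType F} {k r0 : nat}.
Implicit Types (xi alpha : L) (v : ambient L k r0).

Lemma horner_Wpoly xi v alpha : (Wpoly xi v).[alpha] = Wform xi alpha v.
Proof.
rewrite /Wpoly hornerD hornerZ hornerXn horner_poly /Wform.
congr (_ + _); last exact: mulrC.
by apply: eq_bigr => i _; rewrite valK /= mulrC.
Qed.

Lemma coef_Wpoly xi v (i : 'I_k.-1) : (Wpoly xi v)`_i = v.1 i.
Proof.
rewrite coefD coef_poly ltn_ord valK coefZ coefXn.
by rewrite (ltn_eqF (ltn_ord i)) mulr0 addr0.
Qed.

Lemma coef_Wpoly_last xi v :
  (Wpoly xi v)`_k.-1 = \sum_(j < r0) v.2 0 j *: xi ^+ j.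
Proof. by rewrite coefD coef_poly ltnn coefZ coefXn eqxx mulr1 add0r. Qed.

Lemma size_Wpoly_le xi v : (0 < k)%N -> (size (Wpoly xi v) <= k)%N.
Proof.
move=> k_gt0; apply: leq_trans (size_polyD _ _) _; rewrite geq_max.
rewrite (leq_trans (size_poly _ _)) ?leq_pred //=.
by rewrite (leq_trans (size_scale_leq _ _)) // size_polyXn prednK.
Qed.

Lemma size_Wpoly_trunc xi v m :
  v.2 = 0 -> (forall i : 'I_k.-1, (m <= i)%N -> v.1 i = 0) ->
  (size (Wpoly xi v) <= m)%N.
Proof.
move=> z0 x0; apply/leq_sizeP => j le_mj.
rewrite coefD coef_poly big1 => [|i _]; last by rewrite z0 mxE scale0r.
rewrite scale0r coef0 addr0; case: ifP => // lt_jk.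
by rewrite insubT /= x0.
Qed.

(** The low coefficients give the [x] part directly. The last one is a single element of [L], and
    independence of the powers of [xi] recovers all of [z] from it. *)
Lemma Wpoly_eq0 xi v :
  free [seq xi ^+ i | i <- iota 0 r0] -> Wpoly xi v = 0 -> v = 0.
Proof.
move=> xi_free p0.
have x0 i : v.1 i = 0 by rewrite -(coef_Wpoly xi) p0 coef0.
have z0: v.2 = 0.
  have sz: size [seq xi ^+ i | i <- iota 0 r0] == r0.
    by rewrite size_map size_iota.
  have /freeP := xi_free : free (Tuple sz).
  move=> /(_ (fun j => v.2 0 j)) free0.
  apply/rowP => j; rewrite mxE; apply: free0.
  transitivity (Wpoly xi v)`_k.-1; last by rewrite p0 coef0.
  rewrite coef_Wpoly_last; apply: eq_bigr => i _.
  by rewrite (nth_map 0%N) ?size_iota // nth_iota.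
case: v x0 z0 {p0} => x z /= x0 ->; congr (_, _).
by apply/ffunP => i; rewrite ffunE.
Qed.

(** The count runs over the parameters [alpha], which are distinct roots of a nonzero polynomial, so
    no injectivity of [W] enters. *)
Lemma count_W_lt xi v :
  free [seq xi ^+ i | i <- iota 0 r0] -> v != 0 ->
  (count (fun U : {vspace ambient L k r0} => v \in U)
         [seq W k r0 xi alpha | alpha : finvect_type L]
     < size (Wpoly xi v))%N.
Proof.
move=> xi_free v_neq0; rewrite count_map -size_filter.
apply: max_poly_roots (filter_uniq _ (enum_uniq _)).
  by apply: contra v_neq0 => /eqP/(Wpoly_eq0 _ _ xi_free)/eqP.
apply/allP => alpha; rewrite mem_filter /= mem_W => /andP[W_alpha _].
by rewrite rootE horner_Wpoly.
Qed.

(** Each further membership lowers the size bound by one. Bounding the sum lets the strict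
    inequality of [count_W_lt] be added to it. *)
Lemma size_Wpoly_count_Winf xi v (Y S : 'I_3 -> {vspace L}) :
  (3 <= k)%N -> (\bigcap_(i < 3) Y i)%VS = 0%VS ->
  (forall i j, i != j -> (S i :&: S j)%VS = 0%VS) ->
  (size (Wpoly xi v)
     + count (fun U : {vspace ambient L k r0} => v \in U)
             [seq Winf k r0 (Y i) (S i) | i : 'I_3] <= k)%N.
Proof.
move=> k_ge3 capY capS; rewrite count_map -size_filter.
set s := filter _ _; set p := Wpoly xi v.
have s_uniq : uniq s by rewrite filter_uniq ?enum_uniq.
have sP i : i \in s -> v \in Winf k r0 (Y i) (S i).
  by rewrite mem_filter => /andP[].
have le0 : (size p <= k)%N by apply: size_Wpoly_le; lia.
have z0 : (0 < size s)%N -> v.2 = 0.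
  by case: s sP {s_uniq} => // i s' /(_ i (mem_head _ _)) /mem_Winf[].
have s0 : (1 < size s)%N ->
    forall i : 'I_k.-1, i = (k - 2)%N :> nat -> v.1 i = 0.
  case: s sP s_uniq {z0} => [|a [|b s']] // sP /andP[]; rewrite inE negb_or.
  case/andP=> ab _ _ _ i ik; apply/eqP; rewrite -memv0 -(capS a b ab) memv_cap.
  have /mem_Winf[_ -> // _] := sP a (mem_head _ _).
  by have /mem_Winf[_ -> // _] : v \in Winf k r0 (Y b) (S b)
    by apply: sP; rewrite !inE eqxx orbT.
have y0 : (2 < size s)%N ->
    forall i : 'I_k.-1, i = (k - 3)%N :> nat -> v.1 i = 0.
  move=> s_gt2 i ik; apply/eqP; rewrite -memv0 -capY memvE.
  apply/subv_bigcapP => j _; rewrite -memvE.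
  suff /sP/mem_Winf[-> //] : j \in s.
  (* A duplicate-free [s] with three elements exhausts ['I_3], so the coordinate lies in every
     [Y j]. *)
  have [||_ ->] := uniq_min_size s_uniq (s2 := enum 'I_3); rewrite ?mem_enum //.
  - by move=> i' _; rewrite mem_enum.
  - by rewrite -cardE card_ord.
have s_le3 : (size s <= 3)%N.
  by rewrite -(card_uniqP s_uniq) (leq_trans (max_card _)) ?card_ord.
have le1 : (0 < size s)%N -> (size p <= k.-1)%N.
  move=> /z0 v2; apply: size_Wpoly_trunc => // i.
  by have := ltn_ord i; lia.
have le2 : (1 < size s)%N -> (size p <= k - 2)%N.
  move=> s_gt1; apply: size_Wpoly_trunc => [|i ki]; first by apply: z0; lia.
  by apply: s0 => //; have := ltn_ord i; lia.
have le3 : (2 < size s)%N -> (size p <= k - 3)%N.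
  move=> s_gt2; apply: size_Wpoly_trunc => [|i ki]; first by apply: z0; lia.
  (* Only the indices [k - 3] and [k - 2] remain: [y0] handles the first, [s0] the second. *)
  have [ik|ik] := eqVneq (i : nat) (k - 3)%N; first exact: y0.
  by apply: s0; [lia | have := ltn_ord i; lia].
(* By [s_le3] there are four possible values of [size s], settled by [le0] to [le3]; [k_ge3] keeps
   the subtractions from truncating. *)
lia.
Qed.

Lemma packing_Lfamily xi (Y S : 'I_3 -> {vspace L}) :
  free [seq xi ^+ i | i <- iota 0 r0] ->
  (3 <= k)%N -> (\bigcap_(i < 3) Y i)%VS = 0%VS ->
  (forall i j, i != j -> (S i :&: S j)%VS = 0%VS) ->
  packing (k - 1) (Lfamily k r0 xi Y S).
Proof.
move=> xi_free k_ge3 capY capS P dimP.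
(* A line lies in a subspace iff its generator does, which reduces the count to one nonzero
   vector. *)
have P_line : P = <[vpick P]>%VS.
  apply/esym/eqP; rewrite eqEdim -memvE memv_pick dimP dim_vline vpick0.
  by rewrite -dimv_eq0 dimP.
have v_neq0 : vpick P != 0 by rewrite vpick0 -dimv_eq0 dimP.
rewrite (eq_count (a2 := fun U : {vspace ambient L k r0} => vpick P \in U));
  last first.
  by move=> U; rewrite {1}P_line -memvE.
have lt_W := count_W_lt xi (vpick P) xi_free v_neq0.
have le_inf := size_Wpoly_count_Winf xi (vpick P) Y S k_ge3 capY capS.
rewrite count_cat subn1 -ltnS prednK; last by lia.
exact: leq_trans (leq_add lt_W (leqnn _)) le_inf.
Qed.

Lemma W_inj xi : (3 <= k)%N -> injective (W k r0 xi).
Proof.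
move=> k_ge3 a b eqW.
have k0 : (0 < k.-1)%N by lia.
have k1 : (1 < k.-1)%N by lia.
(* These are the coefficients of [a - X], whose only root is [a]; degree 1 lies below [k.-1] because
   [k >= 3]. *)
pose v : ambient L k r0 :=
  ([ffun i : 'I_k.-1 => if i == Ordinal k0 then a
                        else if i == Ordinal k1 then -1 else 0], 0).
have WvE c : Wform xi c v = a - c.
  rewrite /Wform [X in _ + _ * X]big1 ?mulr0 ?addr0 => [|i _]; last first.
    by rewrite mxE scale0r.
  rewrite (bigD1 (Ordinal k0)) // (bigD1 (Ordinal k1)) //= !ffunE /= big1.
    by rewrite mul1r addr0 mulrN1.
  by move=> i /andP[/negPf i0 /negPf i1]; rewrite ffunE i0 i1 mulr0.
have : v \in W k r0 xi a by rewrite mem_W WvE subrr.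
by rewrite eqW mem_W WvE subr_eq0 => /eqP.
Qed.

(** A vector supported on the coordinate [k - 2] alone tests membership in [S] only, and the spaces
    [S i] are nonzero with trivial pairwise intersections. *)
Lemma Winf_inj (Y S : 'I_3 -> {vspace L}) :
  (3 <= k)%N -> (forall i, S i != 0%VS) ->
  (forall i j, i != j -> (S i :&: S j)%VS = 0%VS) ->
  injective (fun i => Winf k r0 (Y i) (S i)).
Proof.
move=> k_ge3 S_neq0 capS a b eqW; apply/eqP/negPn/negP => ab.
have kP : (k - 2 < k.-1)%N by lia.
pose s := vpick (S a).
pose v : ambient L k r0 :=
  ([ffun i : 'I_k.-1 => if i == Ordinal kP then s else 0], 0).
have : v \in Winf k r0 (Y a) (S a).
  apply/mem_Winf; split=> // i ik; rewrite ffunE.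
    by rewrite -val_eqE /= ik ifN ?mem0v //; lia.
  by rewrite -val_eqE /= ik eqxx memv_pick.
rewrite eqW => /mem_Winf[_ /(_ (Ordinal kP) erefl)]; rewrite ffunE eqxx => sb _.
have : s \in (S a :&: S b)%VS by rewrite memv_cap memv_pick.
by rewrite capS // memv0 vpick0 (negPf (S_neq0 a)).
Qed.

Lemma W_neq_Winf xi alpha (Y S : {vspace L}) :
  (3 <= k)%N -> (0 < r0)%N -> W k r0 xi alpha <> Winf k r0 Y S.
Proof.
move=> k_ge3 r0_gt0 eqW.
have k0 : (0 < k.-1)%N by lia.
pose z : 'rV[F]_r0 := delta_mx 0 (Ordinal r0_gt0).
(* The first unit vector as [z] contributes [alpha ^+ k.-1], since [xi ^+ 0 = 1]; coordinate 0
   cancels it. Its nonzero [z] excludes it from any [Winf]. *)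
pose v : ambient L k r0 :=
  ([ffun i : 'I_k.-1 => if i == Ordinal k0 then - alpha ^+ k.-1 else 0], z).
have : v \in W k r0 xi alpha.
  rewrite mem_W /Wform (bigD1 (Ordinal k0)) //= ffunE eqxx.
  rewrite big1 => [|i]; last first.
    by move=> /negPf i0; rewrite ffunE i0 mulr0.
  rewrite (bigD1 (Ordinal r0_gt0)) //= [in X in _ + X]big1 => [|i]; last first.
    by move=> /negPf i0; rewrite mxE i0 andbF scale0r.
  by rewrite mxE !eqxx !expr0 scale1r mul1r !addr0 mulr1 addNr.
rewrite eqW => /mem_Winf[_ _ /rowP/(_ (Ordinal r0_gt0))] /eqP.
by rewrite !mxE !eqxx oner_eq0.
Qed.

(** Without repetitions, counting with multiplicity agrees with counting members of the set of
    subspaces. *)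
Lemma uniq_Lfamily xi (Y S : 'I_3 -> {vspace L}) :
  (3 <= k)%N -> (0 < r0)%N -> (forall i, S i != 0%VS) ->
  (forall i j, i != j -> (S i :&: S j)%VS = 0%VS) ->
  uniq (Lfamily k r0 xi Y S).
Proof.
move=> k_ge3 r0_gt0 S_neq0 capS; rewrite cat_uniq; apply/and3P; split.
- by rewrite map_inj_uniq ?enum_uniq //; apply: W_inj.
- apply/hasPn => _ /mapP[i _ ->]; apply/negP => /mapP[alpha _] /esym.
  exact: W_neq_Winf.
- by rewrite map_inj_uniq ?enum_uniq //; apply: Winf_inj.
Qed.

Lemma size_Lfamily xi (Y S : 'I_3 -> {vspace L}) :
  size (Lfamily k r0 xi Y S) = (#|F| ^ \dim {:L} + 3)%N.
Proof.
rewrite size_cat !size_image card_ord; congr (_ + _)%N.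
by rewrite -(card_vspace {:finvect_type L}); apply: eq_card => x; rewrite memvf.
Qed.

End Packing.

Theorem theorem4p6 (q h k r0 r1 r2 : nat)
  (F : finFieldType) (L : fieldExtType F)
  (cardF : #|F| = q) (dimL : \dim {:L} = h)
  (h_ge6 : (6 <= h)%N) (h_neq7 : h <> 7%N)
  (k_ge3 : (3 <= k)%N) (k_le : (k <= q ^ h - 1)%N)
  (r0_gt0 : (0 < r0)%N) (r1_gt0 : (0 < r1)%N) (r2_gt0 : (0 < r2)%N)
  (r0_le : (6 * r0 <= h)%N) (r1_le : (3 * r1 <= 2 * h)%N)
  (r2_le : (2 * r2 <= h)%N) (r12 : (r1 + r2 = h + r0)%N)
  (xi : L) (xi_basis : basis_of {:L} [seq xi ^+ i | i <- iota 0 h])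
  (Y S : 'I_3 -> {vspace L})
  (dimY : forall i, \dim (Y i) = r1)
  (capY : (\bigcap_(i < 3) Y i)%VS = 0%VS)
  (dimS : forall i, \dim (S i) = r2)
  (capS : forall i j, i != j -> (S i :&: S j)%VS = 0%VS) :
  [/\ uniq (Lfamily k r0 xi Y S),
      size (Lfamily k r0 xi Y S) = (q ^ h + 3)%N
    & packing (k - 1) (Lfamily k r0 xi Y S)].
Proof.
have r0_le_h : (r0 <= h)%N by lia.
(* The [r0] powers of [xi] paired with [z] form an initial segment of the basis, hence a free
   family. *)
have xi_free : free [seq xi ^+ i | i <- iota 0 r0].
  move: (basis_free xi_basis); rewrite -(subnKC r0_le_h) iotaD map_cat.
  exact: catl_free.
split.
- by apply: uniq_Lfamily => // i; rewrite -dimv_eq0 dimS -lt0n.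
- by rewrite size_Lfamily cardF dimL.
- exact: packing_Lfamily.
Qed.
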